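(* Let $\tau\in\mathbf{C}$ satisfy $-\frac12<\Re(\tau)\le\frac12$, $\Im(\tau)>0$, $|\tau|\ge 1$, and $\Re(\tau)\ge 0$ if $|\tau|=1$. Let $$E_2=\lim_{N\to\infty}\sum_{n=-N}^{N}\ \lim_{M\to\infty}\sum_{m=-M}^{M}\frac{1}{(m+n\tau)^2},\qquad \widetilde{E}_2=\lim_{K\to\infty}\sum_{|m|,|n|\le K}\frac{1}{(m+n\tau)^2}.$$ Then $$E_2=\widetilde{E}_2-\frac{4i}{\tau}\arctan(i\tau).$$
   Context: In all sums $m,n$ are integers and the term $m=n=0$ is omitted. $\arctan$ is the principal branch of the complex arctangent (cuts along the imaginary axis where $|\Im|\ge1$); $i\tau$ has negative real part. *)

(* Defs.v *)
From Stdlib Require Import Reals ZArith.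
From Coquelicot Require Import Coquelicot.

Open Scope R_scope.

(* The sum of [f k] over the integers k with -N <= k <= N;
   [sum_n] includes its upper index, so there are 2N+1 terms. *)
Definition sum_sym (N : nat) (f : Z -> C) : C :=
  sum_n (fun k : nat => f (Z.of_nat k - Z.of_nat N)%Z) (2 * N).

Definition is_lim_C (u : nat -> C) (l : C) : Prop :=
  filterlim u eventually (locally l).

Definition eis_term (tau : C) (m n : Z) : C :=
  if (Z.eqb m 0 && Z.eqb n 0)%bool then RtoC 0
  else (/ (RtoC (IZR m) + RtoC (IZR n) * tau) ^ 2)%C.

(* [E] is the iterated limit, with the sum over m innermost: every inner limit
   [row n] exists, and so does the outer one. *)
Definition is_E2 (tau E : C) : Prop :=
  exists row : Z -> C,
    (forall n : Z,
       is_lim_C (fun M : nat => sum_sym M (fun m => eis_term tau m n)) (row n))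
    /\ is_lim_C (fun N : nat => sum_sym N row) E.

Definition is_E2_square (tau E : C) : Prop :=
  is_lim_C
    (fun K : nat => sum_sym K (fun n => sum_sym K (fun m => eis_term tau m n))) E.

(* Principal argument, in (-PI, PI]; the value at 0 is irrelevant. *)
Definition Carg (z : C) : R :=
  if Rlt_dec (Im z) 0 then - acos (Re z / Cmod z) else acos (Re z / Cmod z).

Definition Clog (z : C) : C := (ln (Cmod z), Carg z).

(* Principal branch: (Log (1 + iz) - Log (1 - iz)) / (2i), whose cuts are the
   points of the imaginary axis with |Im z| >= 1. *)
Definition Catan (z : C) : C :=
  ((Clog (1 + Ci * z) - Clog (1 - Ci * z)) / (2 * Ci))%C.

(* Main.v *)
Require Import Defs.
From Stdlib Require Import Reals ZArith Lra Lia ClassicalEpsilon.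
From Coquelicot Require Import Coquelicot.

Open Scope R_scope.

(** Write z = m + n tau.  Subtracting from 1/z^2 the term
    1/(z - 1/2) - 1/(z + 1/2) = 1/(z^2 - 1/4) leaves a remainder of size
    O(|z|^-4) = O((1 + m^2)^-1 (1 + n^2)^-1), whose iterated and square sums
    agree.  The subtracted term telescopes in m: its row sums vanish in the
    limit, while its sum over the square |m|, |n| <= K is
    -2 sum_{|n| <= K} 1/(K + 1/2 + n tau).  With step h = 1/(K + 1/2) this is,
    up to the factor -2, exactly the midpoint Riemann sum on [-1, 1] of
    1/(1 + y tau), and so tends to
    -(2/tau) (Log (1 + tau) - Log (1 - tau)) = (4i/tau) arctan (i tau). *)

(** * Limits of complex sequences through the modulus *)

Lemma is_lim_C_Cmod (u : nat -> C) (l : C) :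
  is_lim_C u l <-> is_lim_seq (fun n => Cmod (u n - l)) 0.
Proof.
  unfold is_lim_C; rewrite filterlim_locally_ball_norm.
  split.
  - intros H; apply is_lim_seq_spec; intros e.
    generalize (H e); apply filter_imp; intros n.
    rewrite Rminus_0_r, Rabs_pos_eq by apply Cmod_ge_0; auto.
  - intros H e; apply is_lim_seq_spec in H.
    generalize (H e); apply filter_imp; intros n.
    rewrite Rminus_0_r, Rabs_pos_eq by apply Cmod_ge_0; auto.
Qed.

Lemma is_lim_C_le (u : nat -> C) (l : C) (e : nat -> R) :
  (forall n, Cmod (u n - l) <= e n) -> is_lim_seq e 0 -> is_lim_C u l.
Proof.
  intros Hle He; apply is_lim_C_Cmod.
  apply is_lim_seq_le_le with (u := fun _ => 0) (w := e); auto.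
  - intros n; split; [apply Cmod_ge_0 | auto].
  - apply is_lim_seq_const.
Qed.

Lemma is_lim_C_ext (u v : nat -> C) (l : C) :
  (forall n, u n = v n) -> is_lim_C u l -> is_lim_C v l.
Proof. intros H; apply filterlim_ext; auto. Qed.

Lemma is_lim_C_plus (u v : nat -> C) (l k : C) :
  is_lim_C u l -> is_lim_C v k -> is_lim_C (fun n => (u n + v n)%C) (l + k)%C.
Proof.
  rewrite !is_lim_C_Cmod; intros Hu Hv; apply -> is_lim_C_Cmod.
  apply is_lim_C_le with (e := fun n => Cmod (u n - l) + Cmod (v n - k)).
  - intros n.
    replace (u n + v n - (l + k))%C with ((u n - l) + (v n - k))%C by ring.
    apply Cmod_triangle.
  - replace (Finite 0) with (Finite (0 + 0)) by (f_equal; ring).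
    now apply is_lim_seq_plus'.
Qed.

Lemma is_lim_C_scal (a : C) (u : nat -> C) (l : C) :
  is_lim_C u l -> is_lim_C (fun n => (a * u n)%C) (a * l)%C.
Proof.
  rewrite !is_lim_C_Cmod; intros Hu; apply -> is_lim_C_Cmod.
  apply is_lim_C_le with (e := fun n => Cmod a * Cmod (u n - l)).
  - intros n.
    replace (a * u n - a * l)%C with (a * (u n - l))%C by ring.
    rewrite Cmod_mult; lra.
  - replace (Finite 0) with (Rbar_mult (Cmod a) 0) by (simpl; f_equal; ring).
    now apply is_lim_seq_scal_l.
Qed.

Lemma is_lim_seq_const_div_S (c : R) :
  is_lim_seq (fun N => c / (INR N + 1)) 0.
Proof.
  apply is_lim_seq_ext with (fun N => c * / INR (S N)).
  { intros N; rewrite S_INR; reflexivity. }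
  replace (Finite 0) with (Rbar_mult c 0) by (simpl; f_equal; ring).
  apply is_lim_seq_scal_l.
  apply (is_lim_seq_incr_1 (fun n => / INR n)).
  replace (Finite 0) with (Rbar_inv p_infty) by reflexivity.
  apply is_lim_seq_inv; [apply is_lim_seq_INR | discriminate].
Qed.

(** * Symmetric sums over the integers and their quadratic majorants *)

Lemma sum_sym_0 (f : Z -> C) : sum_sym 0 f = f 0%Z.
Proof. unfold sum_sym; simpl; rewrite sum_O; reflexivity. Qed.

Lemma sum_sym_S (N : nat) (f : Z -> C) :
  sum_sym (S N) f
  = (sum_sym N f + (f (- Z.of_nat (S N))%Z + f (Z.of_nat (S N))))%C.
Proof.
  unfold sum_sym.
  replace (2 * S N)%nat with (S (S (2 * N))) by lia.
  (* Both ends of the range 0..2N+2 are peeled off; shifting the remaining indices 1..2N+1 down by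
     one matches the change of centre from N+1 to N. *)
  rewrite sum_Sn; unfold sum_n at 1.
  rewrite sum_Sn_m, <- sum_n_m_S by lia.
  rewrite (sum_n_m_ext _ (fun k : nat => f (Z.of_nat k - Z.of_nat N)%Z))
    by (intros k; f_equal; lia).
  unfold sum_n.
  replace (Z.of_nat 0 - Z.of_nat (S N))%Z with (- Z.of_nat (S N))%Z by lia.
  replace (Z.of_nat (S (S (2 * N))) - Z.of_nat (S N))%Z
    with (Z.of_nat (S N)) by lia.
  change (@plus C_AbelianMonoid) with Cplus; ring.
Qed.

Lemma sum_sym_ext (N : nat) (f g : Z -> C) :
  (forall k, f k = g k) -> sum_sym N f = sum_sym N g.
Proof. intros H; unfold sum_sym; apply sum_n_ext; auto. Qed.

Lemma sum_sym_plus (N : nat) (f g : Z -> C) :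
  sum_sym N (fun k => (f k + g k)%C) = (sum_sym N f + sum_sym N g)%C.
Proof.
  induction N as [|N IH]; [now rewrite !sum_sym_0|].
  rewrite !sum_sym_S, IH; ring.
Qed.

Lemma sum_sym_scal (N : nat) (a : C) (f : Z -> C) :
  sum_sym N (fun k => (a * f k)%C) = (a * sum_sym N f)%C.
Proof.
  induction N as [|N IH]; [now rewrite !sum_sym_0|].
  rewrite !sum_sym_S, IH; ring.
Qed.

Lemma sum_sym_opp_index (N : nat) (f : Z -> C) :
  sum_sym N (fun k => f (- k)%Z) = sum_sym N f.
Proof.
  induction N as [|N IH]; [now rewrite !sum_sym_0|].
  rewrite !sum_sym_S, IH, Z.opp_involutive; ring.
Qed.

(* [4c/(N+1)] is a telescoping majorant for the tails of [c/(1+k^2)], [|k| > N]. *)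
Lemma pair_term_bound (N : nat) (c : R) (x y : C) :
  Cmod x <= c / (1 + IZR (- Z.of_nat (S N)) ^ 2) ->
  Cmod y <= c / (1 + IZR (Z.of_nat (S N)) ^ 2) ->
  Cmod (x + y) <= 4 * c / (INR N + 1) - 4 * c / (INR (S N) + 1).
Proof.
  rewrite opp_IZR, <- INR_IZR_INZ, S_INR; intros Hx Hy.
  pose proof (pos_INR N) as HN; pose proof (Cmod_ge_0 x) as Hx0.
  pose proof (Cmod_triangle x y) as Ht.
  set (r := INR N + 1) in *.
  replace ((- r) ^ 2) with (r ^ 2) in Hx by ring.
  assert (Hr : 1 <= r) by (unfold r; lra).
  assert (Hc : 0 <= c).
  { assert (H : 0 <= c / (1 + r ^ 2)) by lra.
    apply (Rmult_le_compat_r (1 + r ^ 2)) in H; [|nra].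
    replace (c / (1 + r ^ 2) * (1 + r ^ 2)) with c in H by (field; nra). lra. }
  (* The telescoping difference exceeds the two terms by a multiple of r^2 - r + 2, whose
     discriminant is negative. *)
  assert (H : 4 * c / r - 4 * c / (r + 1) - 2 * (c / (1 + r ^ 2))
              = c * (2 * (r ^ 2 - r + 2) / (r * (r + 1) * (1 + r ^ 2)))).
  { field; repeat split; nra. }
  assert (0 <= c * (2 * (r ^ 2 - r + 2) / (r * (r + 1) * (1 + r ^ 2)))).
  { apply Rmult_le_pos; [lra|].
    apply Rmult_le_pos; [nra|].
    left; apply Rinv_0_lt_compat; repeat apply Rmult_lt_0_compat; nra. }
  lra.
Qed.

Lemma majorant_ge_0 (f : Z -> C) (c : R) :
  (forall k, Cmod (f k) <= c / (1 + IZR k ^ 2)) -> 0 <= c.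
Proof.
  intros Hf; pose proof (Hf 0%Z); pose proof (Cmod_ge_0 (f 0%Z)).
  replace (c / (1 + IZR 0 ^ 2)) with c in * by (simpl; field). lra.
Qed.

Lemma sum_sym_bound (f : Z -> C) (c : R) :
  (forall k, Cmod (f k) <= c / (1 + IZR k ^ 2)) ->
  forall N, Cmod (sum_sym N f) <= 5 * c.
Proof.
  intros Hf N.
  pose proof (majorant_ge_0 f c Hf) as Hc.
  assert (H : Cmod (sum_sym N f) <= 5 * c - 4 * c / (INR N + 1)).
  { induction N as [|N IH].
    - rewrite sum_sym_0; pose proof (Hf 0%Z) as H.
      replace (c / (1 + IZR 0 ^ 2)) with c in H by (simpl; field).
      simpl; lra.
    - rewrite sum_sym_S.
      pose proof (pair_term_bound N c _ _ (Hf (- Z.of_nat (S N))%Z)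
                    (Hf (Z.of_nat (S N)))).
      eapply Rle_trans; [apply Cmod_triangle|]. lra. }
  assert (0 <= 4 * c / (INR N + 1)).
  { apply Rmult_le_pos; [lra|]; left; apply Rinv_0_lt_compat.
    pose proof (pos_INR N); lra. }
  lra.
Qed.

Lemma sum_sym_tail (f : Z -> C) (c : R) :
  (forall k, Cmod (f k) <= c / (1 + IZR k ^ 2)) ->
  forall N p, Cmod (sum_sym (N + p) f - sum_sym N f)
              <= 4 * c / (INR N + 1) - 4 * c / (INR (N + p) + 1).
Proof.
  intros Hf N p; induction p as [|p IH].
  - rewrite Nat.add_0_r.
    replace (sum_sym N f - sum_sym N f)%C with (RtoC 0) by ring.
    rewrite Cmod_0; lra.
  - rewrite Nat.add_succ_r, sum_sym_S.
    set (x := f _); set (y := f _).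
    pose proof (pair_term_bound (N + p) c x y (Hf _) (Hf _)) as H.
    replace (sum_sym (N + p) f + (x + y) - sum_sym N f)%C
      with ((sum_sym (N + p) f - sum_sym N f) + (x + y))%C by ring.
    eapply Rle_trans; [apply Cmod_triangle|]. lra.
Qed.

(** The tail bound makes the partial sums Cauchy. The explicit rate is recorded because
    [double_sum_cv] needs convergence of the rows with control in n. *)
Lemma sum_sym_cv (f : Z -> C) (c : R) :
  (forall k, Cmod (f k) <= c / (1 + IZR k ^ 2)) ->
  exists l : C, is_lim_C (fun N => sum_sym N f) l /\
    forall N, Cmod (sum_sym N f - l) <= 4 * c / (INR N + 1).
Proof.
  intros Hf.
  pose proof (majorant_ge_0 f c Hf) as Hc.
  assert (Htail : forall N M, (N <= M)%nat ->
            Cmod (sum_sym M f - sum_sym N f) <= 4 * c / (INR N + 1)).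
  { intros N M HM.
    pose proof (sum_sym_tail f c Hf N (M - N)) as H.
    replace (N + (M - N))%nat with M in H by lia.
    assert (0 <= 4 * c / (INR M + 1)).
    { apply Rmult_le_pos; [lra|]; left; apply Rinv_0_lt_compat.
      pose proof (pos_INR M); lra. }
    lra. }
  assert (Hex : exists l : C, is_lim_C (fun N => sum_sym N f) l).
  { apply (proj1 (filterlim_locally_cauchy (U := C_CompleteNormedModule)
                    (F := eventually) (fun N => sum_sym N f))).
    intros e.
    (* Two partial sums beyond N each lie within 4c/(N+1) of the N-th one. *)
    pose proof (is_lim_seq_const_div_S (8 * c)) as Hlim.
    apply is_lim_seq_spec in Hlim; destruct (Hlim e) as [N HN].
    exists (fun n => (N <= n)%nat); split; [now exists N|].
    intros n m Hn Hm.
    apply C_NormedModule_mixin_compat1.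
    change (Cmod (sum_sym m f - sum_sym n f) < e).
    replace (sum_sym m f - sum_sym n f)%C
      with ((sum_sym m f - sum_sym N f) + - (sum_sym n f - sum_sym N f))%C by ring.
    eapply Rle_lt_trans; [apply Cmod_triangle|]. rewrite Cmod_opp.
    specialize (HN N (Nat.le_refl N)).
    rewrite Rminus_0_r in HN; apply Rabs_lt_between in HN.
    pose proof (Htail N n Hn); pose proof (Htail N m Hm).
    replace (8 * c / (INR N + 1))
      with (4 * c / (INR N + 1) + 4 * c / (INR N + 1)) in HN
      by (field; pose proof (pos_INR N); lra).
    lra. }
  destruct Hex as [l Hl]; exists l; split; [exact Hl|].
  intros N; apply is_lim_C_Cmod in Hl.
  apply Rle_plus_epsilon; intros e He.
  apply is_lim_seq_spec in Hl; destruct (Hl (mkposreal e He)) as [M HM].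
  specialize (HM (N + M)%nat ltac:(lia)); simpl in HM.
  rewrite Rminus_0_r in HM; apply Rabs_lt_between in HM.
  pose proof (Htail N (N + M)%nat ltac:(lia)) as H.
  rewrite <- Cmod_opp in H.
  replace (sum_sym N f - l)%C
    with (- (sum_sym (N + M) f - sum_sym N f) + (sum_sym (N + M) f - l))%C by ring.
  eapply Rle_trans; [apply Cmod_triangle|]. lra.
Qed.

(** The row of index n converges at rate 4B/((1+n^2)(M+1)), which is itself summable in n. Replacing
    all rows truncated at K by their limits thus costs O(1/(K+1)), so square sums and iterated sums
    share one limit. *)
Lemma double_sum_cv (D : Z -> Z -> C) (B : R) :
  (forall m n, Cmod (D m n) <= B / (1 + IZR n ^ 2) / (1 + IZR m ^ 2)) ->
  exists (row : Z -> C) (S : C),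
    (forall n, is_lim_C (fun M => sum_sym M (fun m => D m n)) (row n)) /\
    is_lim_C (fun N => sum_sym N row) S /\
    is_lim_C (fun K => sum_sym K (fun n => sum_sym K (fun m => D m n))) S.
Proof.
  intros HD.
  set (P := fun (n : Z) (l : C) => is_lim_C (fun M => sum_sym M (fun m => D m n)) l /\
    forall M, Cmod (sum_sym M (fun m => D m n) - l)
              <= 4 * (B / (1 + IZR n ^ 2)) / (INR M + 1)).
  assert (Hrow : forall n, exists l, P n l).
  { intros n; apply sum_sym_cv; intros m; apply HD. }
  set (row := fun n => proj1_sig (constructive_indefinite_description _ (Hrow n))).
  assert (Hr : forall n, P n (row n)).
  { intros n; unfold row; now destruct constructive_indefinite_description. }
  (* The rate at M = 0 puts the row limit within 4B/(1+n^2) of its central term, which is at most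
     B/(1+n^2). *)
  assert (Hb : forall n, Cmod (row n) <= 5 * B / (1 + IZR n ^ 2)).
  { intros n; destruct (Hr n) as [_ H]; specialize (H 0%nat).
    rewrite sum_sym_0 in H; pose proof (HD 0%Z n) as H0.
    assert (0 < 1 + IZR n ^ 2) by nra.
    replace (B / (1 + IZR n ^ 2) / (1 + IZR 0 ^ 2))
      with (B / (1 + IZR n ^ 2)) in H0 by (simpl; field; lra).
    replace (row n) with (D 0%Z n + - (D 0%Z n - row n))%C by ring.
    eapply Rle_trans; [apply Cmod_triangle|]. rewrite Cmod_opp.
    simpl INR in H.
    replace (4 * (B / (1 + IZR n ^ 2)) / (0 + 1))
      with (4 * (B / (1 + IZR n ^ 2))) in H by (field; lra).
    replace (5 * B / (1 + IZR n ^ 2))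
      with (5 * (B / (1 + IZR n ^ 2))) by (field; lra).
    lra. }
  destruct (sum_sym_cv row (5 * B) Hb) as [S [HS _]].
  exists row, S; split; [intros n; apply Hr|split; [exact HS|]].
  apply is_lim_C_ext with (fun K => (sum_sym K row
     + sum_sym K (fun n => sum_sym K (fun m => D m n) - row n))%C).
  { intros K; rewrite <- sum_sym_plus; apply sum_sym_ext; intros; ring. }
  replace S with (S + 0)%C by ring.
  apply is_lim_C_plus; [exact HS|].
  apply is_lim_C_le with (e := fun K => 20 * B / (INR K + 1));
    [|apply is_lim_seq_const_div_S].
  intros K.
  replace (sum_sym K (fun n => sum_sym K (fun m => D m n) - row n) - 0)%C
    with (sum_sym K (fun n => sum_sym K (fun m => D m n) - row n))%C by ring.
  pose proof (pos_INR K).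
  (* The row errors have the quadratic majorant with constant 4B/(K+1), and [sum_sym_bound]
     contributes the factor 5. *)
  replace (20 * B / (INR K + 1)) with (5 * (4 * B / (INR K + 1))) by (field; lra).
  apply sum_sym_bound; intros n.
  destruct (Hr n) as [_ Hn]; specialize (Hn K).
  assert (0 < 1 + IZR n ^ 2) by nra.
  replace (4 * B / (INR K + 1) / (1 + IZR n ^ 2))
    with (4 * (B / (1 + IZR n ^ 2)) / (INR K + 1)) by (field; lra).
  exact Hn.
Qed.

(** * Lower bounds on the lattice and the quartic remainder *)

Lemma Cmod_pow2_linear (tau : C) (x y : R) :
  Cmod (RtoC x + RtoC y * tau) ^ 2 = (x + y * Re tau) ^ 2 + (y * Im tau) ^ 2.
Proof. rewrite Cmod2_alt; destruct tau; simpl; ring. Qed.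

(** With t = Re tau, the difference of the two sides is (1/2+t)(x+y)^2 + (1/2-t)(x-y)^2 +
    2y^2(|tau|^2-1), a sum of nonnegative terms. *)
Lemma Cmod_linear_lower_bound (tau : C) (x y : R) :
  - (1 / 2) <= Re tau <= 1 / 2 -> 1 <= Cmod tau ->
  x ^ 2 + y ^ 2 <= 2 * Cmod (RtoC x + RtoC y * tau) ^ 2.
Proof.
  intros Ht H1; rewrite Cmod_pow2_linear.
  assert (HT : 1 <= Re tau ^ 2 + Im tau ^ 2) by (rewrite <- Cmod2_alt; apply pow_R1_Rle; exact H1).
  set (t := Re tau) in *; set (s := Im tau) in *.
  assert (0 <= (1 / 2 + t) * (x + y) ^ 2) by (apply Rmult_le_pos; [lra | apply pow2_ge_0]).
  assert (0 <= (1 / 2 - t) * (x - y) ^ 2) by (apply Rmult_le_pos; [lra | apply pow2_ge_0]).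
  assert (0 <= y ^ 2 * (t ^ 2 + s ^ 2 - 1)) by (apply Rmult_le_pos; [apply pow2_ge_0 | lra]).
  nra.
Qed.

(* Telescoping in [m], and equal to [1 / (z ^ 2 - 1 / 4)] at [z = m + n tau]. *)
Definition tele_term (tau : C) (m n : Z) : C :=
  (/ (RtoC (IZR m - 1 / 2) + RtoC (IZR n) * tau)
   - / (RtoC (IZR m + 1 / 2) + RtoC (IZR n) * tau))%C.

(** The half-integer shifts leave boundary terms at the symmetric points -(M+1/2) and M+1/2; both
    the vanishing of the rows and the midpoint sum rest on this. *)
Lemma sum_sym_tele_term (tau : C) (n : Z) (M : nat) :
  sum_sym M (fun m => tele_term tau m n)
  = (/ (RtoC (- (INR M + 1 / 2)) + RtoC (IZR n) * tau)
     - / (RtoC (INR M + 1 / 2) + RtoC (IZR n) * tau))%C.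
Proof.
  induction M as [|M IH].
  - rewrite sum_sym_0; unfold tele_term; simpl INR.
    replace (0 - 1 / 2) with (- (0 + 1 / 2)) by ring; reflexivity.
  - rewrite sum_sym_S, IH; unfold tele_term.
    rewrite opp_IZR, <- INR_IZR_INZ, S_INR.
    replace (- (INR M + 1) - 1 / 2) with (- (INR M + 1 + 1 / 2)) by ring.
    replace (- (INR M + 1) + 1 / 2) with (- (INR M + 1 / 2)) by field.
    replace (INR M + 1 - 1 / 2) with (INR M + 1 / 2) by field.
    ring.
Qed.

Lemma Cmod_gt_0_pow2 (z : C) : 0 < Cmod z ^ 2 -> 0 < Cmod z.
Proof. intros H; pose proof (Cmod_ge_0 z); nra. Qed.

(** The difference is (m-1)(3m-1), negative only for 1/3 < m < 1, where there is no integer. *)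
Lemma half_shift_bound (m : Z) : IZR m ^ 2 <= 4 * (IZR m - 1 / 2) ^ 2.
Proof.
  destruct (Z_le_gt_dec m 0) as [H|H].
  - apply IZR_le in H; nra.
  - assert (H' : (1 <= m)%Z) by lia; apply IZR_le in H'; nra.
Qed.

Lemma inv_sq_sub_tele_eq (z p q : C) :
  p = (z - RtoC (1 / 2))%C -> q = (z + RtoC (1 / 2))%C ->
  z <> 0 -> p <> 0 -> q <> 0 ->
  (/ z ^ 2 - (/ p - / q))%C = (- (RtoC (1 / 4)) / (z ^ 2 * (p * q)))%C.
Proof.
  intros Hp Hq Hz Hp0 Hq0.
  assert (Hd : (q - p = 1)%C).
  { rewrite Hp, Hq.
    replace (z + RtoC (1 / 2) - (z - RtoC (1 / 2)))%C
      with (RtoC (1 / 2) + RtoC (1 / 2))%C by ring.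
    rewrite <- RtoC_plus; f_equal; field. }
  replace (/ p - / q)%C with ((q - p) / (p * q))%C by (field; auto).
  replace (RtoC (1 / 4)) with (RtoC (1 / 2) * RtoC (1 / 2))%C
    by (rewrite <- RtoC_mult; f_equal; field).
  (* Since pq = z^2 - 1/4, the numerator -1/4 equals pq - z^2. *)
  replace (- (RtoC (1 / 2) * RtoC (1 / 2)))%C with (p * q - z * z)%C
    by (rewrite Hp, Hq; ring).
  rewrite Hd; field; auto.
Qed.

(** With r = m^2 + n^2, the bounds |z|^2 >= r/2 and |pq| >= r/8 give at most 4/r^2 = 16/(2r)^2. As r
    >= 1, both 1+m^2 and 1+n^2 are at most 2r, which separates the variables. *)
Lemma inv_sq_sub_tele_bound (tau : C) (m n : Z) :
  - (1 / 2) <= Re tau <= 1 / 2 -> 1 <= Cmod tau ->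
  1 <= IZR m ^ 2 + IZR n ^ 2 ->
  Cmod (/ (RtoC (IZR m) + RtoC (IZR n) * tau) ^ 2 - tele_term tau m n)
  <= 16 / (1 + IZR n ^ 2) / (1 + IZR m ^ 2).
Proof.
  intros Ht H1 Hr; unfold tele_term.
  pose proof (Cmod_linear_lower_bound tau (IZR m) (IZR n) Ht H1) as Hz.
  pose proof (Cmod_linear_lower_bound tau (IZR m - 1 / 2) (IZR n) Ht H1) as Hp.
  pose proof (Cmod_linear_lower_bound tau (IZR m + 1 / 2) (IZR n) Ht H1) as Hq.
  pose proof (half_shift_bound m) as Hs.
  pose proof (half_shift_bound (- m)) as Hs'; rewrite opp_IZR in Hs'.
  pose proof (pow2_ge_0 (IZR m)); pose proof (pow2_ge_0 (IZR n)).
  assert (Hpz : (RtoC (IZR m - 1 / 2) + RtoC (IZR n) * tau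
                 = RtoC (IZR m) + RtoC (IZR n) * tau - RtoC (1 / 2))%C)
    by (rewrite RtoC_minus; ring).
  assert (Hqz : (RtoC (IZR m + 1 / 2) + RtoC (IZR n) * tau
                 = RtoC (IZR m) + RtoC (IZR n) * tau + RtoC (1 / 2))%C)
    by (rewrite RtoC_plus; ring).
  set (z := (RtoC (IZR m) + RtoC (IZR n) * tau)%C) in *.
  set (p := (RtoC (IZR m - 1 / 2) + RtoC (IZR n) * tau)%C) in *.
  set (q := (RtoC (IZR m + 1 / 2) + RtoC (IZR n) * tau)%C) in *.
  set (r := IZR m ^ 2 + IZR n ^ 2) in *.
  assert (Hp8 : r / 8 <= Cmod p ^ 2) by (unfold r in *; lra).
  assert (Hq8 : r / 8 <= Cmod q ^ 2) by (unfold r in *; nra).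
  assert (Hz0 : 0 < Cmod z) by (apply Cmod_gt_0_pow2; lra).
  assert (Hp0 : 0 < Cmod p) by (apply Cmod_gt_0_pow2; lra).
  assert (Hq0 : 0 < Cmod q) by (apply Cmod_gt_0_pow2; lra).
  assert (Hpq : r / 8 <= Cmod p * Cmod q).
  { assert ((r / 8) * (r / 8) <= Cmod p ^ 2 * Cmod q ^ 2)
      by (apply Rmult_le_compat; lra).
    apply Rsqr_incr_0_var; [unfold Rsqr; nra | nra]. }
  rewrite (inv_sq_sub_tele_eq z p q Hpz Hqz) by (now apply Cmod_gt_0).
  rewrite Cmod_div, Cmod_opp, Cmod_R, !Cmod_mult, Cmod_pow, Rabs_pos_eq;
    [| lra | apply Cmod_gt_0; rewrite !Cmod_mult, Cmod_pow;
             apply Rmult_lt_0_compat; [apply pow_lt | apply Rmult_lt_0_compat]; assumption].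
  apply Rle_trans with (1 / 4 / (r / 2 * (r / 8))).
  - apply Rmult_le_compat_l; [lra|]; apply Rinv_le_contravar; [nra|].
    apply Rmult_le_compat; lra.
  - replace (1 / 4 / (r / 2 * (r / 8))) with (16 * / (2 * r * (2 * r)))
      by (field; lra).
    replace (16 / (1 + IZR n ^ 2) / (1 + IZR m ^ 2))
      with (16 * / ((1 + IZR n ^ 2) * (1 + IZR m ^ 2))) by (field; lra).
    apply Rmult_le_compat_l; [lra|]; apply Rinv_le_contravar.
    + apply Rmult_lt_0_compat; lra.
    + apply Rmult_le_compat; unfold r in *; lra.
Qed.

Lemma eis_sub_tele_bound (tau : C) (m n : Z) :
  - (1 / 2) <= Re tau <= 1 / 2 -> 1 <= Cmod tau ->
  Cmod (eis_term tau m n - tele_term tau m n)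
  <= 16 / (1 + IZR n ^ 2) / (1 + IZR m ^ 2).
Proof.
  intros Ht H1; unfold eis_term.
  destruct (Z.eqb m 0 && Z.eqb n 0)%bool eqn:E.
  - apply andb_prop in E as [Em En].
    apply Z.eqb_eq in Em, En; subst; unfold tele_term.
    (* At the origin the omitted term counts as 0 while the telescoping term is -4, so the
       difference is 4, below 16. *)
    replace (RtoC (0 - 1 / 2) + RtoC 0 * tau)%C with (RtoC (- (1 / 2)))
      by (replace (0 - 1 / 2) with (- (1 / 2)) by ring; ring).
    replace (RtoC (0 + 1 / 2) + RtoC 0 * tau)%C with (RtoC (1 / 2))
      by (replace (0 + 1 / 2) with (1 / 2) by ring; ring).
    rewrite <- !RtoC_inv by lra.
    rewrite <- !RtoC_minus, Cmod_R.
    replace (0 - (/ - (1 / 2) - / (1 / 2))) with 4 by field.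
    rewrite Rabs_pos_eq; simpl; lra.
  - apply inv_sq_sub_tele_bound; auto.
    apply Bool.andb_false_iff in E.
    rewrite !pow_IZR, <- plus_IZR; apply IZR_le; simpl Z.of_nat.
    rewrite !Z.eqb_neq in E; nia.
Qed.

Lemma tele_row_lim (tau : C) (n : Z) :
  - (1 / 2) <= Re tau <= 1 / 2 -> 1 <= Cmod tau ->
  is_lim_C (fun M => sum_sym M (fun m => tele_term tau m n)) 0.
Proof.
  intros Ht H1.
  apply is_lim_C_le with (e := fun M => 8 / (INR M + 1));
    [|apply is_lim_seq_const_div_S].
  intros M; rewrite sum_sym_tele_term.
  set (a := INR M + 1 / 2); pose proof (pos_INR M) as HM.
  assert (Hb : forall x, x ^ 2 = a ^ 2 ->
            Cmod (/ (RtoC x + RtoC (IZR n) * tau)) <= 4 / (INR M + 1)).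
  { intros x Hx.
    pose proof (Cmod_linear_lower_bound tau x (IZR n) Ht H1) as H.
    set (z := (RtoC x + RtoC (IZR n) * tau)%C) in *.
    (* Here |z|^2 >= a^2/2 and a = M+1/2 >= (M+1)/2; the constant 1/4 leaves room for the factor
       sqrt 2. *)
    assert (H2 : (INR M + 1) / 4 <= Cmod z).
    { apply Rsqr_incr_0_var; [|apply Cmod_ge_0].
      unfold Rsqr, a in *; nra. }
    assert (Hz : 0 < Cmod z) by lra.
    rewrite Cmod_inv by (now apply Cmod_gt_0).
    replace (4 / (INR M + 1)) with (/ ((INR M + 1) / 4)) by (field; lra).
    apply Rinv_le_contravar; lra. }
  pose proof (Hb (- a) ltac:(ring)) as Hm; pose proof (Hb a eq_refl) as Hp.
  set (u := (/ (RtoC (- a) + _))%C) in *; set (v := (/ (RtoC a + _))%C) in *.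
  replace (u - v - 0)%C with (u + - v)%C by ring.
  eapply Rle_trans; [apply Cmod_triangle|]; rewrite Cmod_opp.
  replace (8 / (INR M + 1)) with (4 / (INR M + 1) + 4 / (INR M + 1))
    by (field; lra).
  lra.
Qed.

(** * The principal logarithm along the segment 1 + y tau *)

(** In the right half-plane acos (x/r) = atan (|y|/x), and the case split in [Carg] restores the
    sign of y. The arctangent form avoids that split and is easy to differentiate. *)
Lemma Carg_atan (z : C) : 0 < Re z -> Carg z = atan (Im z / Re z).
Proof.
  intros Hx.
  assert (Hr : Cmod z ^ 2 = Re z ^ 2 + Im z ^ 2) by apply Cmod2_alt.
  assert (H0 : 0 < Cmod z).
  { apply Cmod_gt_0; intros E; rewrite E in Hx; simpl in Hx; lra. }
  set (x := Re z) in *; set (y := Im z) in *; set (r := Cmod z) in *.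
  assert (Ha : acos (x / r) = atan (Rabs y / x)).
  { rewrite acos_atan by (apply Rdiv_lt_0_compat; lra).
    replace (1 - (x / r)²) with (Rsqr (Rabs y / r)).
    - rewrite sqrt_Rsqr.
      + f_equal; field; lra.
      + apply Rmult_le_pos; [apply Rabs_pos|]; left; now apply Rinv_0_lt_compat.
    - rewrite Rsqr_div', <- Rsqr_abs, Rsqr_div'; unfold Rsqr.
      apply Rmult_eq_reg_r with (r * r); [|nra].
      replace (y * y / (r * r) * (r * r)) with (y * y) by (field; lra).
      replace ((1 - x * x / (r * r)) * (r * r)) with (r ^ 2 - x * x) by (field; lra).
      rewrite Hr; ring. }
  unfold Carg; fold x y r; rewrite Ha.
  destruct (Rlt_dec y 0) as [Hy|Hy].
  - rewrite Rabs_left, <- atan_opp by lra; f_equal; field; lra.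
  - rewrite Rabs_pos_eq by lra; reflexivity.
Qed.

Lemma Clog_ln_atan (tau : C) (y : R) :
  0 < 1 + y * Re tau ->
  Clog (1 + RtoC y * tau)%C
  = (ln ((1 + y * Re tau) ^ 2 + (y * Im tau) ^ 2) / 2,
     atan (y * Im tau / (1 + y * Re tau))).
Proof.
  intros H.
  assert (Hre : Re (1 + RtoC y * tau)%C = 1 + y * Re tau)
    by (destruct tau; simpl; ring).
  assert (Him : Im (1 + RtoC y * tau)%C = y * Im tau)
    by (destruct tau; simpl; ring).
  unfold Clog; f_equal.
  - rewrite <- Cmod_pow2_linear, ln_pow; [simpl INR; field|].
    apply Cmod_gt_0; intros E; rewrite E in Hre; simpl in Hre; lra.
  - rewrite Carg_atan, Hre, Him by lra; reflexivity.
Qed.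

(** The derivative in y of Log (1 + y tau), that is, tau times the integrand of the Riemann sum. *)
Definition dlog (tau : C) (y : R) : C := (tau / (1 + RtoC y * tau))%C.

Lemma dlog_coords (tau : C) (y : R) :
  0 < 1 + y * Re tau ->
  dlog tau y
  = ((Re tau + y * (Re tau ^ 2 + Im tau ^ 2))
       / ((1 + y * Re tau) ^ 2 + (y * Im tau) ^ 2),
     Im tau / ((1 + y * Re tau) ^ 2 + (y * Im tau) ^ 2)).
Proof.
  destruct tau as [t s]; simpl Re; simpl Im; intros H.
  unfold dlog, Cdiv, Cinv, Cmult, Cplus, RtoC; simpl.
  f_equal; field; nra.
Qed.

Lemma is_derive_log_re (tau : C) (y : R) :
  0 < 1 + y * Re tau ->
  is_derive (fun y => ln ((1 + y * Re tau) ^ 2 + (y * Im tau) ^ 2) / 2) y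
    (Re (dlog tau y)).
Proof.
  intros H; rewrite dlog_coords by exact H; simpl Re.
  auto_derive; [nra|]. field; nra.
Qed.

Lemma is_derive_log_im (tau : C) (y : R) :
  0 < 1 + y * Re tau ->
  is_derive (fun y => atan (y * Im tau / (1 + y * Re tau))) y
    (Im (dlog tau y)).
Proof.
  intros H; rewrite dlog_coords by exact H; simpl Im.
  auto_derive; [lra|]. unfold Rsqr. field; split; nra.
Qed.

(** Keeps the segment 1 + y tau, |y| <= 1, away from 0 and from the cut of the logarithm. *)
Lemma Re_line_lower_bound (t y : R) :
  - (1 / 2) <= t <= 1 / 2 -> -1 <= y <= 1 -> 1 / 2 <= 1 + y * t.
Proof. intros; nra. Qed.

(** The difference is tau^2 (y-x) / ((1 + x tau)(1 + y tau)), and each factor below has modulus at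
    least 1/2, whence the 4. *)
Lemma dlog_lipschitz (tau : C) (x y : R) :
  - (1 / 2) <= Re tau <= 1 / 2 -> -1 <= x <= 1 -> -1 <= y <= 1 ->
  Cmod (dlog tau x - dlog tau y) <= 4 * Cmod tau ^ 2 * Rabs (x - y).
Proof.
  intros Ht Hx Hy.
  assert (Hb : forall w, -1 <= w <= 1 -> 1 / 2 <= Cmod (1 + RtoC w * tau)).
  { intros w Hw; eapply Rle_trans; [|eapply Rle_trans; [apply Rle_abs|apply re_le_Cmod]].
    replace (Re (1 + RtoC w * tau)%C) with (1 + w * Re tau)
      by (destruct tau; simpl; ring).
    now apply Re_line_lower_bound. }
  pose proof (Hb x Hx) as Bx; pose proof (Hb y Hy) as By.
  assert (Nx : (1 + RtoC x * tau <> 0)%C) by (apply Cmod_gt_0; lra).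
  assert (Ny : (1 + RtoC y * tau <> 0)%C) by (apply Cmod_gt_0; lra).
  replace (dlog tau x - dlog tau y)%C
    with (tau ^ 2 * RtoC (y - x) / ((1 + RtoC x * tau) * (1 + RtoC y * tau)))%C
    by (unfold dlog; rewrite RtoC_minus; field; auto).
  rewrite Cmod_div by (apply Cmod_gt_0; rewrite Cmod_mult; nra).
  rewrite !Cmod_mult, Cmod_pow, Cmod_R, (Rabs_minus_sym y x).
  set (K := Cmod tau ^ 2 * Rabs (x - y)).
  assert (HK : 0 <= K) by (apply Rmult_le_pos; [apply pow2_ge_0 | apply Rabs_pos]).
  replace (4 * Cmod tau ^ 2 * Rabs (x - y)) with (K * / (1 / 2 * (1 / 2)))
    by (unfold K; field).
  apply Rmult_le_compat_l; [exact HK|].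
  apply Rinv_le_contravar; [lra|].
  apply Rmult_le_compat; lra.
Qed.

(** The mean value theorem turns the increment into (b-a) dg x for some x in [a, b]. It is stated
    for real functions, to be applied to real and imaginary parts separately. *)
Lemma derive_increment_bound (g dg : R -> R) (a b c L : R) :
  a <= c <= b ->
  (forall x, a <= x <= b -> is_derive g x (dg x)) ->
  (forall x, a <= x <= b -> Rabs (dg x - dg c) <= L) ->
  Rabs ((b - a) * dg c - (g b - g a)) <= L * (b - a).
Proof.
  intros Hc Hd HL.
  destruct (MVT_gen g a b dg) as [x [Hx ->]].
  - rewrite Rmin_left, Rmax_right by lra; intros x Hx; apply Hd; lra.
  - rewrite Rmin_left, Rmax_right by lra; intros x Hx.
    apply derivable_continuous_pt; exists (dg x).
    apply is_derive_Reals, Hd; lra.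
  - rewrite Rmin_left, Rmax_right in Hx by lra.
    replace ((b - a) * dg c - dg x * (b - a)) with (- (dg x - dg c) * (b - a)) by ring.
    rewrite Rabs_mult, Rabs_Ropp, (Rabs_pos_eq (b - a)) by lra.
    apply Rmult_le_compat_r; [lra|]; apply HL; lra.
Qed.

Lemma im_le_Cmod (z : C) : Rabs (Im z) <= Cmod z.
Proof. eapply Rle_trans; [apply Rmax_r | apply Rmax_Cmod]. Qed.

Lemma Cmod_le_coords (z : C) : Cmod z <= Rabs (Re z) + Rabs (Im z).
Proof.
  replace z with (RtoC (Re z) + Ci * RtoC (Im z))%C at 1
    by (destruct z; unfold RtoC, Ci, Cmult, Cplus; simpl; f_equal; ring).
  eapply Rle_trans; [apply Cmod_triangle|].
  rewrite Cmod_mult, Cmod_Ci, !Cmod_R; lra.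
Qed.

(** The error of one cell: the Lipschitz constant 4|tau|^2 enters once for each coordinate, giving
    8. A quadratic error suffices, since about 2/h cells of length h are summed. *)
Lemma Clog_increment_bound (tau : C) (a b c : R) :
  - (1 / 2) <= Re tau <= 1 / 2 -> -1 <= a -> a <= c <= b -> b <= 1 ->
  Cmod (RtoC (b - a) * dlog tau c
        - (Clog (1 + RtoC b * tau) - Clog (1 + RtoC a * tau)))
  <= 8 * Cmod tau ^ 2 * (b - a) ^ 2.
Proof.
  intros Ht Ha Hc Hb.
  assert (Hpos : forall y, a <= y <= b -> 0 < 1 + y * Re tau).
  { intros y Hy; pose proof (Re_line_lower_bound (Re tau) y Ht); lra. }
  assert (HL : forall x, a <= x <= b ->
            Cmod (dlog tau x - dlog tau c) <= 4 * Cmod tau ^ 2 * (b - a)).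
  { intros x Hx; eapply Rle_trans; [apply dlog_lipschitz; lra|].
    apply Rmult_le_compat_l; [pose proof (pow2_ge_0 (Cmod tau)); lra|].
    apply Rabs_le; lra. }
  pose proof (derive_increment_bound _ (fun y => Re (dlog tau y)) a b c _ Hc
    (fun x Hx => is_derive_log_re tau x (Hpos x Hx))
    (fun x Hx => Rle_trans _ _ _ (re_le_Cmod (dlog tau x - dlog tau c)) (HL x Hx)))
    as HR.
  pose proof (derive_increment_bound _ (fun y => Im (dlog tau y)) a b c _ Hc
    (fun x Hx => is_derive_log_im tau x (Hpos x Hx))
    (fun x Hx => Rle_trans _ _ _ (im_le_Cmod (dlog tau x - dlog tau c)) (HL x Hx)))
    as HI.
  cbv beta in HR, HI; rewrite !Clog_ln_atan by (apply Hpos; lra).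
  set (ra := ln ((1 + a * _) ^ 2 + _) / 2) in *.
  set (rb := ln ((1 + b * _) ^ 2 + _) / 2) in *.
  set (ia := atan (a * _ / _)) in *; set (ib := atan (b * _ / _)) in *.
  eapply Rle_trans; [apply Cmod_le_coords|].
  destruct (dlog tau c) as [u v].
  replace (Re (RtoC (b - a) * (u, v) - ((rb, ib) - (ra, ia)))%C)
    with ((b - a) * Re (u, v) - (rb - ra)) by (simpl; ring).
  replace (Im (RtoC (b - a) * (u, v) - ((rb, ib) - (ra, ia)))%C)
    with ((b - a) * Im (u, v) - (ib - ia)) by (simpl; ring).
  replace (8 * Cmod tau ^ 2 * (b - a) ^ 2)
    with (4 * Cmod tau ^ 2 * (b - a) * (b - a)
          + 4 * Cmod tau ^ 2 * (b - a) * (b - a)) by ring.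
  now apply Rplus_le_compat.
Qed.

(** * The midpoint Riemann sum and the square sums of the telescoping term *)

(** Cells of length h centred at nh, |n| <= N, tile the interval between -(N+1/2)h and (N+1/2)h, so
    the logarithm increments telescope and 2N+1 cell errors add up. The step h is fixed during the
    induction, each stage adding one cell at either end. *)
Lemma dlog_sum_bound (tau : C) (h : R) (N : nat) :
  - (1 / 2) <= Re tau <= 1 / 2 -> 0 < h -> (INR N + 1 / 2) * h <= 1 ->
  Cmod (sum_sym N (fun n => RtoC h * dlog tau (IZR n * h)%R)%C
        - (Clog (1 + RtoC ((INR N + 1 / 2) * h) * tau)
           - Clog (1 + RtoC (- ((INR N + 1 / 2) * h)) * tau)))
  <= (2 * INR N + 1) * (8 * Cmod tau ^ 2 * h ^ 2).
Proof.
  intros Ht Hh; induction N as [|N IH]; intros HN.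
  - rewrite sum_sym_0; simpl INR in *.
    pose proof (Clog_increment_bound tau (- ((0 + 1 / 2) * h)) ((0 + 1 / 2) * h)
                  (0 * h) Ht ltac:(lra) ltac:(lra) ltac:(lra)) as H.
    replace ((0 + 1 / 2) * h - - ((0 + 1 / 2) * h)) with h in H by field.
    lra.
  - rewrite S_INR in HN; pose proof (pos_INR N) as HN0.
    specialize (IH ltac:(lra)).
    rewrite sum_sym_S, opp_IZR, <- INR_IZR_INZ, S_INR.
    set (x := (INR N + 1 / 2) * h) in *.
    replace ((INR N + 1 + 1 / 2) * h) with (x + h) in * by (unfold x; ring).
    assert (Hx : 0 <= x) by (apply Rmult_le_pos; lra).
    assert (Hm : (INR N + 1) * h = x + h / 2) by (unfold x; field).
    replace (- (INR N + 1) * h) with (- (x + h / 2)) by (rewrite <- Hm; ring).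
    rewrite Hm.
    pose proof (Clog_increment_bound tau x (x + h) (x + h / 2)
                  Ht ltac:(lra) ltac:(lra) ltac:(lra)) as H1.
    pose proof (Clog_increment_bound tau (- (x + h)) (- x) (- (x + h / 2))
                  Ht ltac:(lra) ltac:(lra) ltac:(lra)) as H2.
    replace (x + h - x) with h in H1 by ring.
    replace (- x - - (x + h)) with h in H2 by ring.
    set (A := Clog (1 + RtoC x * tau)) in *.
    set (B := Clog (1 + RtoC (- x) * tau)) in *.
    set (E := Clog (1 + RtoC (x + h) * tau)) in *.
    set (F := Clog (1 + RtoC (- (x + h)) * tau)) in *.
    set (s := sum_sym N _) in *.
    set (u := (RtoC h * dlog tau (x + h / 2))%C) in *.
    set (v := (RtoC h * dlog tau (- (x + h / 2)))%C) in *.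
    replace (s + (v + u) - (E - F))%C
      with ((s - (A - B)) + ((u - (E - A)) + (v - (B - F))))%C by ring.
    eapply Rle_trans; [apply Cmod_triangle|].
    eapply Rle_trans; [apply Rplus_le_compat_l, Cmod_triangle|].
    lra.
Qed.

Lemma tele_square_lim (tau : C) :
  - (1 / 2) <= Re tau <= 1 / 2 -> 0 < Im tau ->
  is_lim_C (fun K => sum_sym K (fun n => sum_sym K (fun m => tele_term tau m n)))
    (- (2 / tau) * (Clog (1 + tau) - Clog (1 - tau)))%C.
Proof.
  intros Ht Hs.
  assert (Ht0 : tau <> 0%C) by (intros E; rewrite E in Hs; simpl in Hs; lra).
  (* This step puts the outer endpoints of the 2K+1 cells exactly at -1 and 1. *)
  set (h := fun K => / (INR K + 1 / 2)).
  assert (Hlin : forall a y, a <> 0 -> (RtoC a + RtoC y * tau <> 0)%C).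
  { intros a y Ha E.
    assert (Him : Im (RtoC a + RtoC y * tau)%C = 0) by (rewrite E; reflexivity).
    assert (Hre : Re (RtoC a + RtoC y * tau)%C = 0) by (rewrite E; reflexivity).
    replace (Im (RtoC a + RtoC y * tau)%C) with (y * Im tau) in Him
      by (destruct tau; simpl; ring).
    replace (Re (RtoC a + RtoC y * tau)%C) with (a + y * Re tau) in Hre
      by (destruct tau; simpl; ring).
    apply Rmult_integral in Him as [Hy|Hy]; [rewrite Hy in Hre|]; lra. }
  apply is_lim_C_ext with
    (fun K => (- (2 / tau)
               * sum_sym K (fun n => RtoC (h K) * dlog tau (IZR n * h K)%R))%C).
  { intros K; pose proof (pos_INR K) as HK.
    rewrite <- sum_sym_scal.
    set (f := fun n : Z => (/ (RtoC (INR K + 1 / 2) + RtoC (IZR n) * tau))%C).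
    (* The left boundary term 1/(-(K+1/2) + n tau) is -f(-n), so each row gives -f(n) - f(-n);
       reflecting n then yields -2 times the sum of f. *)
    transitivity (sum_sym K (fun n => (-1) * f n + (-1) * f (- n)%Z)%C).
    - rewrite sum_sym_plus, (sum_sym_opp_index K (fun n => (-1) * f n)%C),
        <- sum_sym_plus.
      apply sum_sym_ext; intros n; unfold f, dlog, h.
      rewrite RtoC_mult, RtoC_inv by lra.
      pose proof (Hlin (INR K + 1 / 2) (IZR n) ltac:(lra)).
      assert (RtoC (INR K + 1 / 2) <> 0%C) by (intros E; apply RtoC_inj in E; lra).
      field; auto.
    - apply sum_sym_ext; intros n; rewrite sum_sym_tele_term; unfold f.
      rewrite opp_IZR, !RtoC_opp.
      pose proof (Hlin (INR K + 1 / 2) (IZR n) ltac:(lra)).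
      pose proof (Hlin (INR K + 1 / 2) (- IZR n) ltac:(lra)) as H2.
      pose proof (Hlin (- (INR K + 1 / 2)) (IZR n) ltac:(lra)) as H3.
      rewrite RtoC_opp in H2, H3.
      field; auto. }
  apply is_lim_C_scal.
  apply is_lim_C_le with (e := fun K => 32 * Cmod tau ^ 2 / (INR K + 1));
    [|apply is_lim_seq_const_div_S].
  intros K; pose proof (pos_INR K) as HK.
  assert (Hh : (INR K + 1 / 2) * h K = 1) by (unfold h; field; lra).
  assert (Hh0 : 0 < h K) by (apply Rinv_0_lt_compat; lra).
  pose proof (dlog_sum_bound tau (h K) K Ht Hh0 ltac:(lra)) as H.
  rewrite Hh in H.
  replace (1 + RtoC 1 * tau)%C with (1 + tau)%C in H by ring.
  replace (1 + RtoC (- (1)) * tau)%C with (1 - tau)%C in H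
    by (rewrite RtoC_opp; ring).
  eapply Rle_trans; [exact H|].
  (* Since (2K+1) h = 2, the accumulated error is linear in h, and h <= 2/(K+1). *)
  replace ((2 * INR K + 1) * (8 * Cmod tau ^ 2 * h K ^ 2))
    with (16 * Cmod tau ^ 2 * h K) by (unfold h; field; lra).
  replace (32 * Cmod tau ^ 2 / (INR K + 1))
    with (16 * Cmod tau ^ 2 * / ((INR K + 1) / 2)) by (field; lra).
  pose proof (pow2_ge_0 (Cmod tau)).
  apply Rmult_le_compat_l; [lra|]; apply Rinv_le_contravar; lra.
Qed.

(** * The arctangent and the comparison of the two sums *)

Lemma Catan_Ci_mult (tau : C) :
  Catan (Ci * tau) = ((Clog (1 - tau) - Clog (1 + tau)) / (2 * Ci))%C.
Proof.
  unfold Catan.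
  replace (Ci * (Ci * tau))%C with (- tau)%C
    by (destruct tau; unfold Ci, Cmult, Copp; simpl; f_equal; ring).
  replace (1 - - tau)%C with (1 + tau)%C by ring.
  reflexivity.
Qed.

Theorem mainTheorem6 :
  forall tau : C,
    - (1 / 2) < Re tau <= 1 / 2 ->
    0 < Im tau ->
    1 <= Cmod tau ->
    (Cmod tau = 1 -> 0 <= Re tau) ->
    exists E2 E2t : C,
      is_E2 tau E2 /\
      is_E2_square tau E2t /\
      E2 = (E2t - 4 * Ci / tau * Catan (Ci * tau))%C.
Proof.
  intros tau Ht0 Hs H1 _.
  assert (Ht : - (1 / 2) <= Re tau <= 1 / 2) by lra.
  destruct (double_sum_cv (fun m n => eis_term tau m n - tele_term tau m n)%C 16)
    as (row & S & Hrow & HS & Hsq).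
  { intros m n; now apply eis_sub_tele_bound. }
  (* The remainder contributes S to both sums; the telescoping term contributes 0 to every row
     limit, but the logarithmic term to the square sums. *)
  exists S, (S + - (2 / tau) * (Clog (1 + tau) - Clog (1 - tau)))%C.
  split; [|split].
  - exists row; split; [|exact HS].
    intros n.
    apply is_lim_C_ext with
      (fun M => (sum_sym M (fun m => eis_term tau m n - tele_term tau m n)
                 + sum_sym M (fun m => tele_term tau m n))%C).
    { intros M; rewrite <- sum_sym_plus; apply sum_sym_ext; intros; ring. }
    replace (row n) with (row n + 0)%C by ring.
    apply is_lim_C_plus; [apply Hrow | now apply tele_row_lim].
  - eapply is_lim_C_ext; [|apply is_lim_C_plus;
                            [exact Hsq | now apply tele_square_lim]].
    intros K; cbv beta; rewrite <- sum_sym_plus.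
    apply sum_sym_ext; intros n; rewrite <- sum_sym_plus.
    apply sum_sym_ext; intros m; ring.
  - rewrite Catan_Ci_mult.
    assert (tau <> 0%C) by (intros E; rewrite E in Hs; simpl in Hs; lra).
    assert (Ci <> 0%C) by (apply Cmod_gt_0; rewrite Cmod_Ci; lra).
    field; auto.
Qed.
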